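(* Let $G$ be a compactly generated locally compact group of polynomial growth, let $U=U^{-1}$ be a relatively compact generating neighbourhood of the identity, let $|x|=\inf\{n\ge1\mid x\in U^n\}$ for $x\in G$, and let $0<\gamma<1$. Then for every $p>1$ the weight $\omega(x)=e^{|x|^\gamma}$ satisfies (LPAlg), up to multiplication of $\omega$ by a positive constant; that is, $\omega$ is submultiplicative and symmetric and there is a constant $C'$ with $\omega^{-q}*\omega^{-q}\le C'\omega^{-q}$ on $G$, where $\frac1p+\frac1q=1$.
   Context: $G$ is of polynomial growth if there are a relatively compact neighbourhood $U$ of the identity with $G=\bigcup_nU^n$ (a ''generating'' neighbourhood) and constants $C,Q$ with $|U^n|\le Cn^Q$ for all $n\ge1$, where $|\cdot|$ is Haar measure of a set; the constant $Q$ does not depend on $U$. It is understood that $U$ is such that the sets $U^n$ are measurable. Symmetric means $\omega(x)=\omega(x^{-1})$, submultiplicative means $\omega(xy)\le\omega(x)\omega(y)$, and $(f*g)(x)=\int_Gf(y)g(y^{-1}x)\,dy$. A weight $\omega:G\to[1,+\infty[$ (measurable) satisfies (LPAlg) if it is submultiplicative, symmetric, and $\omega^{-q}*\omega^{-q}\le\omega^{-q}$. *)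

(* Defs.v *)
From HB Require Import structures.
From mathcomp Require Import all_boot all_order all_algebra.
From mathcomp Require Import all_classical all_reals all_analysis.

Set Implicit Arguments.
Unset Strict Implicit.
Unset Printing Implicit Defensive.

Import Order.TTheory GRing.Theory Num.Theory.
Import numFieldNormedType.Exports.

Local Open Scope classical_set_scope.
Local Open Scope ring_scope.

#[short(type="preTopologicalGroupType")]
HB.structure Definition PreTopologicalGroup := {G of Topological G & Group G}.

HB.mixin Record PreTopologicalGroup_isTopologicalGroup G
    & PreTopologicalGroup G := {
  mulg_continuous : continuous (fun x : G * G => (x.1 * x.2)%g) ;
  invg_continuous : continuous (fun x : G => (x^-1)%g) ;
}.

#[short(type="topologicalGroupType")]
HB.structure Definition TopologicalGroup :=
  {G of PreTopologicalGroup G & PreTopologicalGroup_isTopologicalGroup G}.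

#[short(type="preMeasurableTopologicalGroupType")]
HB.structure Definition PreMeasurableTopologicalGroup d :=
  {G of TopologicalGroup G & Measurable d G}.

(* The sigma-algebra is not fixed to be the Borel one, so that both usual
   conventions (Borel sets, or all Haar measurable sets, i.e., the completion)
   are instances: both contain the open sets and are stable under translations
   and inversion. *)
HB.mixin Record isMeasurableTopologicalGroup d G
    & PreMeasurableTopologicalGroup d G := {
  open_measurableg : forall A : set G, open A -> measurable A ;
  lmulg_measurable : forall (x : G) (A : set G),
    measurable A -> measurable [set (x * y)%g | y in A] ;
  invg_measurable : forall A : set G,
    measurable A -> measurable [set (y^-1)%g | y in A] ;
}.

#[short(type="measurableTopologicalGroupType")]
HB.structure Definition MeasurableTopologicalGroup d :=
  {G of PreMeasurableTopologicalGroup d G & isMeasurableTopologicalGroup d G}.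

Section group_sets.
Variable G : groupType.

Definition set_mulg (A B : set G) : set G := [set (x * y)%g | x in A & y in B].

Definition set_invg (A : set G) : set G := [set (x^-1)%g | x in A].

(* A^n = A ... A (n factors), with A^0 = {1} *)
Definition set_expg (A : set G) (n : nat) : set G :=
  iter n (set_mulg A) [set 1%g].

End group_sets.

Definition locally_compact_group (G : topologicalGroupType) : Prop :=
  hausdorff_space G /\ locally_compact [set: G].

(* the union is the subgroup generated by K *)
Definition compactly_generated (G : topologicalGroupType) : Prop :=
  exists2 K : set G, compact K &
    \bigcup_n set_expg (K `|` set_invg K) n = [set: G].

(* Regularity makes mu the restriction, to the chosen sigma-algebra, of the
   outer measure of the usual Haar (Radon) measure. *)
Record left_haar_measure d (R : realType) (G : measurableTopologicalGroupType d)
    (mu : {measure set G -> \bar R}) : Prop := LeftHaarMeasure {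
  haar_neq0 : mu [set: G] != 0%E ;
  haar_lmulg : forall (x : G) (A : set G),
    measurable A -> mu [set (x * y)%g | y in A] = mu A ;
  haar_compact : forall K : set G, compact K -> (mu K < +oo)%E ;
  haar_outer_regular : forall A : set G, measurable A ->
    mu A = ereal_inf [set mu O | O in [set O | open O /\ A `<=` O]] ;
  haar_inner_regular : forall O : set G, open O ->
    mu O = ereal_sup [set mu K | K in [set K | compact K /\ K `<=` O]]
}.

Record generating_nbhd d (G : measurableTopologicalGroupType d) (U : set G)
  : Prop := GeneratingNbhd {
  generating_nbhd1 : nbhs (1%g : G) U ;
  generating_precompact : precompact U ;
  generating_bigcup : \bigcup_(n in [set n | (1 <= n)%N]) set_expg U n = setT ;
  generating_measurable : forall n, (1 <= n)%N -> measurable (set_expg U n)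
}.

Definition polynomial_growth d (R : realType)
    (G : measurableTopologicalGroupType d) (mu : {measure set G -> \bar R})
    : Prop :=
  exists2 U : set G, generating_nbhd U &
    exists C Q : R, forall n, (1 <= n)%N ->
      (mu (set_expg U n) <= (C * n%:R `^ Q)%:E)%E.

Definition word_length (R : realType) (G : groupType) (U : set G) (x : G) : R :=
  inf [set n%:R | n in [set n | (1 <= n)%N /\ set_expg U n x]].

Definition exp_weight (R : realType) (G : groupType) (U : set G) (gamma : R)
    (x : G) : R :=
  expR (word_length R U x `^ gamma).

Definition convolution d (R : realType) (G : measurableTopologicalGroupType d)
    (mu : {measure set G -> \bar R}) (f g : G -> R) (x : G) : \bar R :=
  (\int[mu]_y (f y * g (y^-1 * x)%g)%:E)%E.

Definition is_weight d (R : realType) (G : measurableTopologicalGroupType d)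
    (w : G -> R) : Prop :=
  measurable_fun setT w /\ forall x, 1 <= w x.

Definition submultiplicative (R : realType) (G : groupType) (w : G -> R)
    : Prop :=
  forall x y : G, w (x * y)%g <= w x * w y.

Definition symmetric_weight (R : realType) (G : groupType) (w : G -> R)
    : Prop :=
  forall x : G, w x = w (x^-1)%g.

Definition inv_pow (R : realType) (G : groupType) (w : G -> R) (q : R) (x : G)
    : R := w x `^ (- q).

Definition LPAlg d (R : realType) (G : measurableTopologicalGroupType d)
    (mu : {measure set G -> \bar R}) (q : R) (w : G -> R) : Prop :=
  [/\ is_weight w, submultiplicative w, symmetric_weight w &
   forall x, (convolution mu (inv_pow w q) (inv_pow w q) x
              <= (inv_pow w q x)%:E)%E].

(* Main.v *)
Require Import Defs.
From mathcomp Require Import all_boot all_order all_algebra.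
From mathcomp Require Import all_classical all_reals all_analysis.
From mathcomp Require Import measurable_realfun.
From mathcomp Require Import ring lra.

Set Implicit Arguments.
Unset Strict Implicit.
Unset Printing Implicit Defensive.

Import Order.TTheory GRing.Theory Num.Theory.
Import numFieldNormedType.Exports.

Local Open Scope classical_set_scope.
Local Open Scope ring_scope.

(* Bernoulli's inequality gives (a + b)^g <= a^g + g * b^g for 0 < b <= a and
   0 <= g <= 1. With a, b the larger and the smaller of |y| and |y^-1 x|, and
   |x| <= a + b, this yields
     w^-q(y) w^-q(y^-1 x) <= w^-q(x) e^(- q (1 - g) b^g),
   so that w^-q * w^-q <= 2 S w^-q, where
     S = \sum_(n >= 1) e^(- q (1 - g) n^g) mu(U^n)
   dominates the integrals of both e^(- q (1 - g) |y|^g) and its translate by x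
   (left invariance of mu). By compactness U lies in some power of a set V of
   polynomial growth, hence mu(U^n) = O(n^Q), and S is finite. *)

(** * Powers of a subset of a group *)

Section powers_of_sets.
Variable G : groupType.
Implicit Types (A B : set G) (x y : G) (m n k : nat).

Lemma set_expgD A m n x y :
  set_expg A m x -> set_expg A n y -> set_expg A (m + n) (x * y)%g.
Proof.
elim: m x => [|m IHm] x /=; first by move=> ->; rewrite mul1g.
move=> [a Aa [b Ab <-]] Ay; exists a => //; exists (b * y)%g; first exact: IHm.
by rewrite mulgA.
Qed.

Lemma set_expg1 A x : A x -> set_expg A 1 x.
Proof. by move=> Ax; exists x => //; exists 1%g => //; rewrite mulg1. Qed.

Lemma set_expg_has1 A n : A 1%g -> set_expg A n 1%g.
Proof.
move=> A1; elim: n => [//|n IHn] /=.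
by exists 1%g => //; exists 1%g => //; rewrite mulg1.
Qed.

Lemma set_expg_mono A m n : A 1%g -> (m <= n)%N ->
  set_expg A m `<=` set_expg A n.
Proof.
move=> A1 /subnKC <- x Ax; rewrite -[x]mulg1.
by apply: set_expgD => //; exact: set_expg_has1.
Qed.

Lemma set_expgV A n x : A = set_invg A -> set_expg A n x ->
  set_expg A n (x^-1)%g.
Proof.
move=> AV; elim: n x => [|n IHn] x /=; first by move=> ->; rewrite invg1.
move=> [a Aa [b Ab <-]]; rewrite invgM.
(* Inversion reverses products, so the new factor appears on the right, whereas [set_expg] adds
   factors on the left; [set_expgD] with exponents [n] and [1] bridges the two. *)
change (set_expg A n.+1 (b^-1 * a^-1)%g).
rewrite -addn1; apply: set_expgD; first exact: IHn.
by apply: set_expg1; rewrite AV; exists a.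
Qed.

Lemma set_expg_subM A B k n : A `<=` set_expg B k ->
  set_expg A n `<=` set_expg B (n * k).
Proof.
move=> AB; elim: n => [//|n IHn] x [a Aa [b Ab <-]].
by rewrite mulSn; apply: set_expgD; [exact: AB|exact: IHn].
Qed.

End powers_of_sets.

(** * Word length of a generating set *)

Section word_length.
Variables (R : realType) (G : groupType) (A : set G).
Hypothesis genA : \bigcup_(n in [set n | (1 <= n)%N]) set_expg A n = setT.

(** The powers cover the group, so a least admissible exponent exists and attains the infimum.
    Writing it as a successor records that it is at least 1. *)
Lemma word_lengthP (x : G) : exists n : nat,
  [/\ word_length R A x = n.+1%:R, set_expg A n.+1 x &
      forall m, (1 <= m)%N -> set_expg A m x -> (n.+1 <= m)%N].
Proof.
have exn : exists n, `[< (1 <= n)%N /\ set_expg A n x >].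
  have : [set: G] x by [].
  by rewrite -genA => -[n n1 Anx]; exists n; apply/asboolP.
case: (ex_minnP exn) => -[|n] /asboolP[// _ Ax] nmin; exists n.
have nlb m : (1 <= m)%N -> set_expg A m x -> (n.+1 <= m)%N.
  by move=> m1 Amx; apply: nmin; apply/asboolP.
split=> //; apply/le_anti/andP; split.
  by apply: ge_inf; [exists 0 => _ [m _ <-]|exists n.+1].
apply: lb_le_inf; first by exists n.+1%:R, n.+1.
by move=> _ [m [m1 Amx] <-]; rewrite ler_nat; exact: nlb.
Qed.

Lemma word_length_ge1 (x : G) : 1 <= word_length R A x.
Proof. by have [n [-> _ _]] := word_lengthP x; rewrite ler1n. Qed.

Lemma word_length_le (x : G) (n : nat) : (1 <= n)%N -> set_expg A n x ->
  word_length R A x <= n%:R.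
Proof.
by move=> n1 An; have [m [-> _ mmin]] := word_lengthP x; rewrite ler_nat mmin.
Qed.

Lemma word_lengthM (x y : G) :
  word_length R A (x * y)%g <= word_length R A x + word_length R A y.
Proof.
have [m [-> Am _]] := word_lengthP x; have [n [-> An _]] := word_lengthP y.
by rewrite -natrD; apply: word_length_le => //; exact: set_expgD.
Qed.

Lemma word_lengthV (x : G) : A = set_invg A ->
  word_length R A (x^-1)%g = word_length R A x.
Proof.
move=> AV; have le y : word_length R A (y^-1)%g <= word_length R A y.
  have [m [-> Am _]] := word_lengthP y.
  by apply: word_length_le => //; exact: set_expgV.
by apply/le_anti; rewrite le /= -{1}[x]invgK le.
Qed.

End word_length.

(** * Inequalities for real powers and stretched exponentials *)

Section real_estimates.
Variable R : realType.
Implicit Types a b g s v Q M : R.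

Lemma powR_bernoulli g v : 0 <= g <= 1 -> 0 < v -> v `^ g <= 1 + g * (v - 1).
Proof.
move=> /andP[g0 g1] v0; set A := 1 + _.
have A0 : 0 < A.
  rewrite /A; have [->|gn0] := eqVneq g 0; first by lra.
  by have : 0 < g * v; [rewrite mulr_gt0 // lt0r gn0|lra].
rewrite -ler_ln ?posrE ?powR_gt0 // ln_powR.
(* Since [A] = g v + (1 - g), the claim g ln v <= ln A is concavity of the logarithm. It follows
   from 1 + ln z <= z at z = v/A and z = 1/A, with weights g and 1 - g: the weighted right sides add
   up to 1. *)
have ln_le (z : R) : 0 < z -> 1 + ln z <= z.
  by move=> z0; rewrite -{2}(lnK z0); exact: expR_ge1Dx.
have := ln_le _ (divr_gt0 v0 A0); have := ln_le A^-1.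
rewrite invr_gt0 lnM ?posrE ?invr_gt0 // lnV ?posrE // => /(_ A0) h1 h2.
have eqA : g * (v / A) + (1 - g) * A^-1 = 1.
  have -> : g * (v / A) + (1 - g) * A^-1 = A / A by rewrite /A; ring.
  by rewrite divff // gt_eqF.
have : g * (1 + (ln v - ln A)) <= g * (v / A) by rewrite ler_wpM2l.
have : (1 - g) * (1 - ln A) <= (1 - g) * A^-1 by rewrite ler_wpM2l // subr_ge0.
lra.
Qed.

(** By homogeneity only u = b/a <= 1 matters: (1 + u)^g <= 1 + g u <= 1 + g u^g. The coefficient g
    on the smaller term, in place of the 1 of plain subadditivity, is the gain that makes the
    convolution converge. *)
Lemma powR_add_le g a b : 0 <= g <= 1 -> 0 < b -> b <= a ->
  (a + b) `^ g <= a `^ g + g * b `^ g.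
Proof.
move=> /andP[g0 g1] b0 ba; have a0 : 0 < a by exact: lt_le_trans ba.
have u0 : 0 < b / a by rewrite divr_gt0.
have u1 : b / a <= 1 by rewrite ler_pdivrMr // mul1r.
have an0 : a != 0 by rewrite gt_eqF.
have eb : b = a * (b / a) by rewrite mulrC divfK.
have -> : a + b = a * (1 + b / a) by rewrite mulrDr mulr1 -eb.
rewrite {2}eb (powRM _ (ltW a0) (ltW u0)) powRM ?addr_ge0 ?(ltW u0) ?(ltW a0) //.
have /powR_bernoulli : 0 <= g <= 1 by rewrite g0.
move=> /(_ (1 + b / a)); rewrite addr_gt0 // => /(_ isT) h.
have h2 : b / a <= (b / a) `^ g by apply: ger1_powR => //; rewrite u0.
have h3 : g * (b / a) <= g * (b / a) `^ g by rewrite ler_wpM2l.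
have -> : a `^ g + g * (a `^ g * (b / a) `^ g) =
  a `^ g * (1 + g * (b / a) `^ g) by ring.
by rewrite ler_wpM2l ?powR_ge0 //; lra.
Qed.

Lemma powR_subadditive g a b : 0 <= g <= 1 -> 0 < a -> 0 < b ->
  (a + b) `^ g <= a `^ g + b `^ g.
Proof.
move=> g01 a0 b0; wlog ba : a b a0 b0 / b <= a => [h|].
  by have [/h|/ltW/h] := leP b a; [exact|rewrite addrC [leRHS]addrC; exact].
apply: le_trans (powR_add_le g01 b0 ba) _.
by rewrite lerD2l ler_piMl ?powR_ge0 //; case/andP: g01.
Qed.

(** The stretched exponential beats every power, here N^(-Q-2). The bound is a telescoping
    difference so that the series can be summed explicitly. *)
Lemma expR_powR_decay g s Q : 0 < g -> 0 < s -> exists2 M : R, 0 <= M &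
  forall n : nat, expR (- (s * n.+1%:R `^ g)) * n.+1%:R `^ Q <=
    M * (n.+1%:R^-1 - n.+2%:R^-1).
Proof.
move=> g0 s0.
(* With this [m], the bound exp(-t) <= (m/t)^m at t = s N^g leaves N^(Q - g m) <= N^(-2). *)
have [m mN0 mQ] : exists2 m : nat, (0 < m)%N & Q + 2 <= g * m%:R.
  exists (Num.bound ((Q + 2) / g)).+1 => //.
  rewrite mulrC -ler_pdivrMr //; apply: le_trans (ler_norm _) _.
  rewrite ltW // (lt_le_trans (archi_boundP (normr_ge0 _))) // ler_nat.
  apply: leq_trans (leqnSn _).
  by rewrite /Num.bound /Num.Def.archi_bound normr_id.
have m0 : 0 < m%:R :> R by rewrite ltr0n.
have c0 : 0 < (m%:R / s) ^+ m by rewrite exprn_gt0 // divr_gt0.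
(* The factor 2 pays for N^(-2) <= 2 / (N (N + 1)), valid for N >= 1. *)
exists (2 * (m%:R / s) ^+ m); first by rewrite mulr_ge0 // ltW.
move=> n; set N : R := n.+1%:R.
have N1 : 1 <= N by rewrite ler1n.
have N0 : 0 < N by rewrite ltr0n.
set t := s * N `^ g.
have t0 : 0 < t by rewrite mulr_gt0 // powR_gt0.
(* This is the m-th power of exp(-z) <= 1/z at z = t/m, a consequence of 1 + z <= exp(z). *)
have ht : expR (- t) <= (m%:R / t) ^+ m.
  have -> : t = m%:R * (t / m%:R) by rewrite mulrC divfK // gt_eqF.
  have d0 : 0 < t / m%:R by rewrite divr_gt0.
  rewrite expRN expRM_natl -exprVn.
  have -> : m%:R / (m%:R * (t / m%:R)) = (t / m%:R)^-1.
    by field; rewrite !gt_eqF.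
  apply: lerXn2r; rewrite ?nnegrE ?invr_ge0 ?expR_ge0 ?(ltW d0) //.
  rewrite lef_pV2 ?posrE ?expR_gt0 //.
  by have := expR_ge1Dx (t / m%:R); lra.
apply: (@le_trans _ _ ((m%:R / t) ^+ m * N `^ Q)).
  by rewrite ler_wpM2r ?powR_ge0.
have -> : m%:R / t = m%:R / s / N `^ g.
  by rewrite /t invfM mulrA.
rewrite exprMn -[leLHS]mulrA -[leRHS]mulrA [leRHS]mulrCA.
rewrite ler_wpM2l ?(ltW c0) //.
have -> : (N `^ g)^-1 ^+ m = N `^ (- (g * m%:R)).
  by rewrite exprVn powRN -powR_mulrn ?powR_ge0 // -powRrM.
rewrite -powRD; last by rewrite (gt_eqF N0) implybT.
apply: (@le_trans _ _ (N `^ (- 2))); first by apply: ler_powR => //; lra.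
rewrite powRN powR_mulrn ?(ltW N0) //.
have -> : n.+2%:R = N + 1 :> R by rewrite /N -[in LHS]addn1 natrD.
have -> : 2 * (N^-1 - (N + 1)^-1) = (N * (N + 1) / 2)^-1.
  by field; rewrite !gt_eqF // addr_gt0.
by rewrite lef_pV2 ?posrE ?exprn_gt0 ?divr_gt0 ?mulr_gt0 ?addr_gt0 //; nra.
Qed.

Lemma nneseries_telescope_le (u : nat -> \bar R) M : 0 <= M ->
  (forall n, 0 <= u n)%E ->
  (forall n, u n <= (M * (n.+1%:R^-1 - n.+2%:R^-1))%:E)%E ->
  (\sum_(0 <= n <oo) u n <= M%:E)%E.
Proof.
move=> M0 u0 uM; apply: lime_le; first exact: is_cvg_nneseries.
apply: nearW => N.
(* The induction needs the exact telescoped value, which is then bounded by [M]. *)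
have : (\sum_(0 <= n < N) u n <= (M * (1 - N.+1%:R^-1))%:E)%E.
  elim: N => [|N IHN]; first by rewrite big_nil invr1 subrr mulr0.
  rewrite big_nat_recr //=; apply: le_trans (leeD IHN (uM N)) _.
  by rewrite -EFinD lee_fin -mulrDr addrA subrK.
move=> /le_trans; apply; rewrite lee_fin.
by rewrite mulrBr mulr1 gerBl mulr_ge0 // invr_ge0.
Qed.

End real_estimates.

(** * Weighted series of indicator functions *)

Section indicator_series.
Variables (d : measure_display) (T : measurableType d) (R : realType).
Variables (mu : {measure set T -> \bar R}) (h : nat -> R) (A : nat -> set T).
Hypotheses (h0 : forall n, 0 <= h n) (mA : forall n, measurable (A n)).

(** Majorant for a radial function: when [A n] runs through balls, [F] is at least [h n] on the n-th
    ball, and its integral involves only the measures of balls, with no passage to disjoint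
    spheres. *)
Let F (y : T) : \bar R := (\sum_(0 <= n <oo) (h n * \1_(A n) y)%:E)%E.

Let term_ge0 n y : (0 <= (h n * \1_(A n) y)%:E)%E.
Proof. by rewrite lee_fin mulr_ge0 // indicE. Qed.

Let measurable_term n : measurable_fun setT (fun y => (h n * \1_(A n) y)%:E).
Proof.
by apply/measurable_EFinP; apply: measurable_funM => //; exact: measurable_indic.
Qed.

Lemma indic_series_ge0 y : (0 <= F y)%E.
Proof. exact: nneseries_ge0. Qed.

Lemma indic_series_ge n y : A n y -> ((h n)%:E <= F y)%E.
Proof.
move=> Any.
have := @nneseries_lim_ge R (fun k => (h k * \1_(A k) y)%:E) xpredT 0 n.+1
  (fun k _ _ => term_ge0 k y).
apply: le_trans; rewrite big_nat_recr //= indicE mem_set // mulr1.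
by apply: leeDr; apply: sume_ge0 => k _.
Qed.

Lemma measurable_indic_series : measurable_fun setT F.
Proof. exact: ge0_emeasurable_sum. Qed.

Lemma integral_indic_series :
  (\int[mu]_y F y = \sum_(0 <= n <oo) (h n)%:E * mu (A n))%E.
Proof.
rewrite integral_nneseries //.
apply: eq_eseriesr => n _.
under eq_integral do rewrite EFinM.
rewrite ge0_integralZl_EFin ?integral_indic ?setIT //.
by apply/measurable_EFinP; exact: measurable_indic.
Qed.

End indicator_series.

(** * Growth of powers of a neighbourhood, and measurability of the length *)

Section growth.
Variables (d : measure_display) (R : realType).
Variables (G : measurableTopologicalGroupType d) (mu : {measure set G -> \bar R}).
Implicit Types (U V : set G).

Lemma measurable_lmulg (x : G) : measurable_fun setT (fun y : G => (x * y)%g).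
Proof.
move=> _ A mA; rewrite setTI.
have -> : (fun y : G => (x * y)%g) @^-1` A = [set (x^-1 * y)%g | y in A].
  apply/seteqP; split=> [y /= Axy|_ [y Ay <-] /=]; last by rewrite mulVKg.
  by exists (x * y)%g => //; rewrite mulKg.
exact: lmulg_measurable.
Qed.

Lemma generating_nbhd_has1 U : generating_nbhd U -> U 1%g.
Proof. by move=> [/nbhs_singleton]. Qed.

(* V^(m+1) is a neighbourhood of every point of V^m, so that the increasing
   sequence V^n eventually contains any given compact set. *)
Lemma precompact_sub_set_expg U V : precompact U -> generating_nbhd V ->
  exists k, U `<=` set_expg V k.
Proof.
move=> [K UK [cK _]] genV; have V1 := generating_nbhd_has1 genV.
have : \forall n \near \oo, K `<=` set_expg V n.
  move/compact_near_coveringP : cK.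
  move=> /(_ _ \oo (fun n x => set_expg V n x)); apply => x Kx.
  have : [set: G] x by [].
  rewrite -(generating_bigcup genV) => -[m _ Vmx].
  have cx : continuous (fun y : G => (x^-1 * y)%g).
    move=> y; apply: (@continuous_comp _ _ _ (fun y : G => (x^-1, y)%g)
      (fun z : G * G => (z.1 * z.2)%g)); last exact: mulg_continuous.
    by apply: cvg_pair => //=; exact: cvg_cst.
  exists ([set y | V (x^-1 * y)%g], [set n | (m.+1 <= n)%N]) => /=.
    split; last by exists m.+1.
    by apply: cx; rewrite mulVg; exact: generating_nbhd1.
  move=> [y n] /= [Vy mn]; apply: (set_expg_mono V1 mn).
  rewrite -(mulVKg x y) -addn1; apply: set_expgD => //.
  exact: set_expg1.
move=> [k _ /(_ k (leqnn k)) KVk]; exists k.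
by move=> y /UK; exact: KVk.
Qed.

(** Polynomial growth provides some neighbourhood V, not the given [U]. From U inside V^k one gets
    U^n inside V^(n k), and k^Q is absorbed into the constant, so the exponent is unchanged. *)
Lemma polynomial_growth_generating U :
  polynomial_growth mu -> generating_nbhd U ->
  exists2 C : R, 0 <= C & exists Q : R,
    forall n : nat, (mu (set_expg U n.+1) <= (C * n.+1%:R `^ Q)%:E)%E.
Proof.
move=> [V genV [C [Q VQ]]] genU.
have [k UVk] := precompact_sub_set_expg (generating_precompact genU) genV.
have V1 := generating_nbhd_has1 genV.
(* A positive exponent ensures that [n.+1 * k.+1] is at least 1, the range in which measurability
   and growth of the powers of [V] are known. *)
have {}UVk : U `<=` set_expg V k.+1.
  by move=> y /UVk; exact: set_expg_mono.
(* The absolute value makes the constant nonnegative, since the sign of [C] is not prescribed. *)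
exists (`|C| * k.+1%:R `^ Q); first by rewrite mulr_ge0 // powR_ge0.
exists Q => n.
apply: (@le_trans _ _ (mu (set_expg V (n.+1 * k.+1)))).
  apply: le_measure; rewrite ?inE; [exact: (generating_measurable genU)|
    exact: (generating_measurable genV)|exact: set_expg_subM].
apply: le_trans (VQ _ _) _ => //; rewrite lee_fin.
rewrite natrM powRM // mulrAC -mulrA ler_wpM2r ?mulr_ge0 ?powR_ge0 //.
exact: ler_norm.
Qed.

Lemma series_expR_growth U g s :
  polynomial_growth mu -> generating_nbhd U -> 0 < g -> 0 < s ->
  exists2 M : R, 0 <= M &
    (\sum_(0 <= n <oo)
       (expR (- (s * n.+1%:R `^ g)))%:E * mu (set_expg U n.+1) <= M%:E)%E.
Proof.
move=> pg genU g0 s0.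
have [C C0 [Q UQ]] := polynomial_growth_generating pg genU.
have [M M0 HM] := expR_powR_decay Q g0 s0.
exists (C * M); first by rewrite mulr_ge0.
apply: nneseries_telescope_le => [|n|n].
- by rewrite mulr_ge0.
- by rewrite mule_ge0 // lee_fin expR_ge0.
- apply: le_trans (lee_wpmul2l _ (UQ n)) _; first by rewrite lee_fin expR_ge0.
  by rewrite -EFinM lee_fin mulrCA -mulrA ler_wpM2l.
Qed.

(** A point has length at least r exactly when it avoids every U^n with 1 <= n < r, so these sets
    are countable intersections of complements of measurable powers. *)
Lemma measurable_word_length U : generating_nbhd U ->
  measurable_fun setT (word_length R U).
Proof.
move=> genU; apply: (measurability (@RGenCInfty.G R)) => [|/= _ [_] [r] -> <-].
  exact: RGenCInfty.measurableE.
rewrite setTI preimage_itvcy.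
have -> : [set x | r <= word_length R U x] =
    \bigcap_(n in [set n | (1 <= n)%N /\ n%:R < r]) ~` set_expg U n.
  apply/seteqP; split=> x /=.
    move=> rx n [n1 nr] Ux.
    have := word_length_le R (generating_bigcup genU) n1 Ux.
    by move=> /(le_trans rx); rewrite leNgt nr.
  move=> h; have [n [-> Ux _]] := word_lengthP R (generating_bigcup genU) x.
  by rewrite leNgt; apply/negP => nr; exact: (h n.+1).
apply: bigcap_measurableType => n [n1 _].
by apply: measurableC; exact: generating_measurable.
Qed.

End growth.

(** * Pointwise bound and measurability of the convolution integrand *)

Lemma expR_powR_split (R : realType) (g q a b l : R) :
  0 <= g <= 1 -> 0 <= q -> 0 < b -> b <= a -> 0 <= l -> l <= a + b ->
  expR (- (q * a `^ g)) * expR (- (q * b `^ g)) <=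
    expR (- (q * l `^ g)) * expR (- (q * (1 - g) * b `^ g)).
Proof.
move=> g01 q0 b0 ba l0 lab; rewrite -!expRD ler_expR.
have lg : l `^ g <= (a + b) `^ g.
  by apply: ge0_ler_powR => //; [case/andP: g01|rewrite nnegrE (le_trans l0)].
have := ler_wpM2l q0 (le_trans lg (powR_add_le g01 b0 ba)).
lra.
Qed.

Lemma inv_pow_ge0 (R : realType) (G : groupType) (w : G -> R) (q : R) (x : G) :
  0 <= inv_pow w q x.
Proof. exact: powR_ge0. Qed.

Lemma measurable_inv_pow (d : measure_display) (R : realType)
    (G : measurableTopologicalGroupType d) (w : G -> R) (q : R) :
  is_weight w -> measurable_fun setT (inv_pow w q).
Proof. by move=> [mw _]; exact: (measurableT_comp (measurable_powR (- q))). Qed.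

Lemma measurable_conv_integrand (d : measure_display) (R : realType)
    (G : measurableTopologicalGroupType d) (w : G -> R) (q : R) (x : G) :
  is_weight w -> symmetric_weight w ->
  measurable_fun setT
    (fun y => (inv_pow w q y * inv_pow w q (y^-1 * x)%g)%:E).
Proof.
move=> ww wV; apply/measurable_EFinP; apply: measurable_funM.
  exact: measurable_inv_pow.
(* Symmetry of the weight replaces y^-1 x by its inverse x^-1 y, turning the factor into a left
   translate. *)
have -> : (fun y => inv_pow w q (y^-1 * x)%g) =
    inv_pow w q \o (fun y => (x^-1 * y)%g).
  by apply/funext => y /=; rewrite /inv_pow wV invgM invgK.
apply: measurableT_comp; first exact: measurable_inv_pow.
exact: measurable_lmulg.
Qed.

(** * The exponential weight and its convolution estimate *)

Section exp_weight.
Variables (d : measure_display) (R : realType).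
Variables (G : measurableTopologicalGroupType d) (mu : {measure set G -> \bar R}).
Variables (U : set G) (g : R).
Hypotheses (Usym : U = set_invg U) (Ugen : generating_nbhd U).
Hypotheses (g0 : 0 < g) (g1 : g < 1).

Let w := exp_weight U g.
Let genU := generating_bigcup Ugen.
Let g01 : 0 <= g <= 1. Proof. by rewrite !ltW. Qed.

Lemma exp_weight_is_weight : is_weight w.
Proof.
split=> [|x]; last by rewrite -expR0 ler_expR powR_ge0.
apply: measurableT_comp => //.
exact: (measurableT_comp (measurable_powR g) (measurable_word_length Ugen)).
Qed.

Lemma exp_weightM : submultiplicative w.
Proof.
move=> x y; rewrite /w /exp_weight -expRD ler_expR.
have lx := lt_le_trans ltr01 (word_length_ge1 R genU x).
have ly := lt_le_trans ltr01 (word_length_ge1 R genU y).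
have lxy := lt_le_trans ltr01 (word_length_ge1 R genU (x * y)%g).
apply: le_trans (powR_subadditive g01 lx ly).
apply: ge0_ler_powR; rewrite ?nnegrE ?addr_ge0 ?(ltW g0) ?(ltW lx)
  ?(ltW ly) ?(ltW lxy) //.
exact: word_lengthM.
Qed.

Lemma exp_weightV : symmetric_weight w.
Proof. by move=> x; rewrite /w /exp_weight word_lengthV. Qed.

Lemma inv_pow_exp_weight (q : R) x :
  inv_pow w q x = expR (- (q * word_length R U x `^ g)).
Proof. by rewrite /inv_pow /w /exp_weight -expRM mulrN mulrC. Qed.

Lemma inv_pow_exp_weight_conv_le (q : R) :
  left_haar_measure mu -> polynomial_growth mu -> 0 < q ->
  exists2 C : R, 0 <= C & forall x : G,
    (convolution mu (inv_pow w q) (inv_pow w q) x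
      <= (C * inv_pow w q x)%:E)%E.
Proof.
move=> haar pg q0.
have s0 : 0 < q * (1 - g) by rewrite mulr_gt0 // subr_gt0.
have [M M0 HM] := series_expR_growth pg Ugen g0 s0.
(* One [M] for the balls around the identity, one for the balls around [x]. *)
exists (M + M) => [|x]; first exact: addr_ge0.
pose h n := expR (- (q * (1 - g) * n.+1%:R `^ g)).
have h0 n : 0 <= h n by exact: expR_ge0.
pose A n := set_expg U n.+1.
have mA n : measurable (A n) by exact: generating_measurable.
pose B n := [set (x * y)%g | y in A n].
have mB n : measurable (B n) by exact: lmulg_measurable.
pose F (D : nat -> set G) (y : G) : \bar R :=
  (\sum_(0 <= n <oo) (h n * \1_(D n) y)%:E)%E.
have mFA : measurable_fun setT (F A) by exact: measurable_indic_series.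
have mFB : measurable_fun setT (F B) by exact: measurable_indic_series.
have FA0 y : (0 <= F A y)%E by exact: indic_series_ge0.
have FB0 y : (0 <= F B y)%E by exact: indic_series_ge0.
have intA : (\int[mu]_y F A y <= M%:E)%E by rewrite integral_indic_series.
have intB : (\int[mu]_y F B y <= M%:E)%E.
  rewrite integral_indic_series //.
  (* Left invariance: the ball x U^n has the measure of U^n. *)
  by under eq_eseriesr do rewrite haar_lmulg //.
set e := inv_pow w q x.
have e0 : 0 <= e by exact: inv_pow_ge0.
have splitle y : ((inv_pow w q y * inv_pow w q (y^-1 * x)%g)%:E
    <= e%:E * (F A y + F B y))%E.
  have [a [la Ua _]] := word_lengthP R genU y.
  have [b [lb Ub _]] := word_lengthP R genU (y^-1 * x)%g.
  have lx0 := le_trans ler01 (word_length_ge1 R genU x).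
  have lx : word_length R U x <= a.+1%:R + b.+1%:R.
    by rewrite -la -lb -{1}(mulVKg y x) word_lengthM.
  rewrite !inv_pow_exp_weight /e inv_pow_exp_weight la lb.
  (* The smaller of the two lengths supplies the decay: if it is that of y^-1 x, then y lies in a
     ball around [x] and [F B] dominates; otherwise [F A] does. *)
  have [ba|/ltW ab] := leP (b.+1%:R : R) a.+1%:R.
    apply: (@le_trans _ _ ((expR (- (q * word_length R U x `^ g)))%:E
        * (h b)%:E)%E).
      by rewrite -EFinM lee_fin expR_powR_split // ltW.
    rewrite lee_wpmul2l ?lee_fin ?expR_ge0 //.
    apply: le_trans (leeDr _ (FA0 y)); apply: indic_series_ge => //.
    (* Symmetry of [U] puts x^-1 y in the same power as its inverse y^-1 x. *)
    exists (x^-1 * y)%g; last by rewrite mulVKg.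
    by rewrite /A -[(x^-1 * y)%g]invgK invgM invgK; exact: set_expgV.
  apply: (@le_trans _ _ ((expR (- (q * word_length R U x `^ g)))%:E
      * (h a)%:E)%E).
    by rewrite mulrC -EFinM lee_fin expR_powR_split // ?(ltW q0) // addrC.
  rewrite lee_wpmul2l ?lee_fin ?expR_ge0 //.
  by apply: le_trans (leeDl _ (FB0 y)); exact: indic_series_ge.
apply: (@le_trans _ _ (\int[mu]_y (e%:E * (F A y + F B y))%E)%E).
  apply: ge0_le_integral => //=.
  - by move=> y _; rewrite lee_fin mulr_ge0 ?inv_pow_ge0.
  - exact: measurable_conv_integrand exp_weight_is_weight exp_weightV.
  - by apply: measurable_funeM; exact: emeasurable_funD.
rewrite ge0_integralZl_EFin // => [|y _|]; last 2 first.
- exact: adde_ge0.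
- exact: emeasurable_funD.
rewrite ge0_integralD // mulrC EFinM lee_wpmul2l ?lee_fin //.
by rewrite EFinD leeD.
Qed.

End exp_weight.

(** * Normalization of the weight and conclusion *)

Lemma LPAlg_scale (d : measure_display) (R : realType)
    (G : measurableTopologicalGroupType d) (mu : {measure set G -> \bar R})
    (q C : R) (w : G -> R) :
  0 < q -> 0 <= C -> is_weight w -> submultiplicative w -> symmetric_weight w ->
  (forall x, (convolution mu (inv_pow w q) (inv_pow w q) x
              <= (C * inv_pow w q x)%:E)%E) ->
  exists2 c : R, 0 < c & LPAlg mu q (fun x => c * w x).
Proof.
move=> q0 C0 [mw w1] wM wV wC.
have C1 : 0 < C + 1 by rewrite ltr_wpDl.
(* Scaling by c multiplies the convolution by c^(-2q) and the right side by c^(-q), so c^q >= C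
   suffices. Taking [C + 1] also gives c >= 1, hence c <= c^2, which preserves the lower bound 1 and
   submultiplicativity. *)
set c := (C + 1) `^ q^-1.
have c1 : 1 <= c.
  rewrite -(powRr0 (C + 1)); apply: ler_powR; first by rewrite lerDr.
  by rewrite invr_ge0 ltW.
have c0 : 0 < c by exact: lt_le_trans c1.
have w0 x : 0 <= w x by exact: le_trans (w1 x).
have powc : c `^ (- q) = (C + 1)^-1.
  by rewrite -powRrM mulrN mulVf ?gt_eqF // powR_inv1 // ltW.
exists c => //; split.
- split=> [|x]; first exact: measurable_funM.
  by rewrite -[1]mulr1 ler_pM.
- move=> x y; rewrite mulrACA -[leRHS]mulrA ler_wpM2l ?(ltW c0) //.
  by apply: le_trans (wM x y) _; rewrite ler_peMl ?mulr_ge0.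
- by move=> x; rewrite wV.
have ce x : inv_pow (fun x => c * w x) q x = (C + 1)^-1 * inv_pow w q x.
  by rewrite /inv_pow powRM ?(ltW c0) // powc.
move=> x; rewrite ce /convolution.
under eq_integral => y _ do rewrite !ce mulrACA EFinM.
rewrite -invfM ge0_integralZl_EFin //; last 3 first.
- by move=> y _; rewrite lee_fin mulr_ge0 ?inv_pow_ge0.
- exact: measurable_conv_integrand.
- by rewrite invr_ge0 mulr_ge0 // ltW.
apply: le_trans (lee_wpmul2l _ (wC x)) _.
  by rewrite lee_fin invr_ge0 mulr_ge0 // ltW.
rewrite -EFinM lee_fin invfM -mulrA ler_wpM2l ?invr_ge0 ?(ltW C1) //.
rewrite mulrA ler_piMl ?inv_pow_ge0 // mulrC ler_pdivrMr // mul1r.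
by rewrite lerDl.
Qed.

Theorem mainTheorem9 (d : measure_display) (R : realType)
    (G : measurableTopologicalGroupType d) (mu : {measure set G -> \bar R})
    (U : set G) (gamma p q : R)
    (lcG : locally_compact_group G) (cgG : compactly_generated G)
    (haar : left_haar_measure mu) (pgG : polynomial_growth mu)
    (Usym : U = set_invg U) (Ugen : generating_nbhd U)
    (gamma_gt0 : 0 < gamma) (gamma_lt1 : gamma < 1)
    (p_gt1 : 1 < p) (pq : p^-1 + q^-1 = 1) :
  let w := exp_weight U gamma in
  [/\ exists2 c : R, 0 < c & LPAlg mu q (fun x => c * w x),
      is_weight w,
      submultiplicative w,
      symmetric_weight w &
      exists C' : R, forall x : G,
        (convolution mu (inv_pow w q) (inv_pow w q) x
          <= (C' * inv_pow w q x)%:E)%E].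
Proof.
have q0 : 0 < q.
  have : p^-1 < 1 by rewrite invf_lt1 // (lt_trans ltr01).
  (* Positivity of the inverse also excludes q = 0, whose inverse is 0 by convention. *)
  by rewrite -invr_gt0; lra.
move=> w.
have [C C0 wC] := inv_pow_exp_weight_conv_le Usym Ugen gamma_gt0 gamma_lt1
  haar pgG q0.
have ww : is_weight w by exact: exp_weight_is_weight.
have wM : submultiplicative w by exact: exp_weightM.
have wV : symmetric_weight w by exact: exp_weightV.
by split => //; [exact: LPAlg_scale wC|exists C].
Qed.
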